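(* Let $q$ be odd and let $u,v,w$ be monic quadratics over $\mathbb F_q$ satisfying ($C_1$) $\operatorname{Disc}(u)\operatorname{Disc}(v)\operatorname{Disc}(w)\neq0$; ($C_2$) $\operatorname{Res}(u,v)\operatorname{Res}(v,w)\operatorname{Res}(w,u)\ne0$; ($C_3$) $\mathfrak d(u,v,w)\neq0$. Let $U=v'w-vw'$, $V=w'u-wu'$, $W=u'v-uv'$. Then $U,V,W$ are pairwise coprime, none has a repeated root, at most one has degree $1$ and the others have degree $2$, and $UVW$ is square-free of degree $5$ or $6$. Consequently an output post-check testing that the factors $U,V,W$ have the expected degrees, are pairwise coprime, and have no repeated roots (nonzero discriminants) is implied by $C_1$–$C_3$ and can be omitted.
   Context: For $u=x^2+u_1x+u_0$, $v=x^2+v_1x+v_0$, $w=x^2+w_1x+w_0$, $$\mathfrak d(u,v,w)=\det\begin{pmatrix} u_0 & u_1 & 1 \\ v_0 & v_1 & 1 \\ w_0 & w_1 & 1 \end{pmatrix}.$$ Derivatives are with respect to $x$. *)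

(* Defs.v *)
From HB Require Import structures.
From mathcomp Require Import all_boot all_order all_algebra all_field.

Set Implicit Arguments.
Unset Strict Implicit.
Unset Printing Implicit Defensive.

Import GRing.Theory.
Local Open Scope ring_scope.

(* Disc p = (-1) ^ (n (n - 1) / 2) * Res_(n, n - 1)(p, p') / lead_coef p with
   n = deg p.  MathComp's [resultant] lists coefficients by increasing degree,
   so [resultant q p] is the classical Res(p, q); and it uses the actual degree
   of p', so the power of [lead_coef p] restores the formal degree n - 1 when
   the characteristic divides n (otherwise its exponent is 0).  With this
   convention every polynomial of degree 1 has discriminant 1. *)
Definition disc (F : fieldType) (p : {poly F}) : F :=
  let n := (size p).-1 in
  (-1) ^+ 'C(n, 2) * lead_coef p ^+ (n - size p^`())%N
    * resultant p^`() p / lead_coef p.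

Definition frakd (F : fieldType) (u v w : {poly F}) : F :=
  \det (\matrix_(i < 3, j < 3)
          (nth [::] [:: [:: u`_0; u`_1; 1];
                        [:: v`_0; v`_1; 1];
                        [:: w`_0; w`_1; 1]] i)`_j).

(* Roots are taken in arbitrary field extensions of F, in particular in an
   algebraic closure. *)
Definition has_repeated_root (F : fieldType) (p : {poly F}) : Prop :=
  exists (L : fieldType) (iota : {rmorphism F -> L}) (a : L),
    ('X - a%:P) ^+ 2 %| map_poly iota p.

Definition squarefree_poly (F : fieldType) (p : {poly F}) : Prop :=
  forall d : {poly F}, d ^+ 2 %| p -> size d = 1%N.

Definition pairwise_coprimep (F : fieldType) (U V W : {poly F}) : bool :=
  [&& coprimep U V, coprimep V W & coprimep W U].

(* [size p] is deg p + 1. *)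
Definition expected_degrees (F : fieldType) (U V W : {poly F}) : bool :=
  all (fun p : {poly F} => (size p == 2)%N || (size p == 3)%N) [:: U; V; W]
  && (count (fun p : {poly F} => (size p == 2)%N) [:: U; V; W] <= 1)%N.

Definition post_check (F : fieldType) (U V W : {poly F}) : bool :=
  [&& expected_degrees U V W, pairwise_coprimep U V W
    & [&& disc U != 0, disc V != 0 & disc W != 0]].

(* Main.v *)
Require Import Defs.
From HB Require Import structures.
From mathcomp Require Import all_boot all_order all_algebra all_field.
From mathcomp Require Import fingroup cyclic ring.

(** The polynomials U, V, W are the pairwise Wronskians of u, v, w, and each
    claim comes from one classical identity.

    - A Wronskian u' v - u v' of two monic quadratics has derivative 2 (v - u).
      A repeated root of it is therefore a common root of v - u and, as u and v
      are coprime, of (v - u)'; since v - u is nonzero of degree at most 1, this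
      is impossible ([separable_wronskian_quadratic]). The coefficients of X^2 and
      X in the Wronskian are v_1 - u_1 and 2 (v_0 - u_0), not both zero, so its
      degree is 2 unless u and v share their coefficient of X, and then 1
      ([size_wronskian_quadratic]).

    - The sum U + V + W is the constant - frakd u v w
      ([wronskian_quadratic_sum]). Combined with the syzygies
      u U + v V + w W = 0 and u' U + v' V + w' W = 0, it shows that a common root
      of two Wronskians is a double root of the third quadratic, contrary to its
      discriminant being nonzero ([coprimep_wronskian]).

    If two Wronskians had degree 1, then u, v, w would share the coefficient of
    X and frakd would vanish. Finally a product of pairwise coprime separable
    polynomials is separable, hence square-free, and its degree is the sum of
    the three degrees, 5 or 6. Separability, meaning coprimality with the
    derivative, is the common form in which discriminants, repeated roots and
    square-freeness are compared. *)

Set Implicit Arguments.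
Unset Strict Implicit.
Unset Printing Implicit Defensive.

Import GRing.Theory.
Local Open Scope ring_scope.

(** Lagrange in the additive group of F gives #|F| = 0 in F, and an odd number
    equal to 0 forces 2 to be a unit. *)
Lemma odd_card_two_neq0 (F : finFieldType) : odd #|F| -> (2%:R : F) != 0.
Proof.
move=> oddF; have cardF0 : (#|F|%:R : F) = 0.
  rewrite -FinRing.zmodXgE; apply/eqP; rewrite -order_dvdn -cardsT.
  exact: order_dvdG (in_setT _).
apply: contra_eq_neq cardF0 => two0.
by rewrite -(odd_double_half #|F|) oddF -muln2 natrD natrM two0 mulr0 addr0
           oner_neq0.
Qed.

(** [resultant_eq0] tests for a gcd of size greater than 1; a gcd of size 0 is
    excluded by [q != 0], so the negation says exactly that the gcd is constant. *)
Lemma resultant_neq0 (F : fieldType) (p q : {poly F}) :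
  q != 0 -> (resultant p q != 0) = coprimep p q.
Proof.
move=> q0; rewrite resultant_eq0 -leqNgt coprimep_def eqn_leq.
by rewrite lt0n size_poly_eq0 gcdp_eq0 (negPf q0) !andbF andbT.
Qed.

(** The sign and the powers of the leading coefficient in [disc] are units, so
    only the resultant of [p] and its derivative matters. This also covers
    degree 1, where [disc] is 1 and every polynomial is separable. *)
Lemma disc_neq0 (F : fieldType) (p : {poly F}) :
  p != 0 -> (disc p != 0) = separable_poly p.
Proof.
move=> p0; rewrite unlock coprimep_sym -resultant_neq0 // /disc.
rewrite !mulf_eq0 invr_eq0 signr_eq0 expf_eq0 lead_coef_eq0.
by rewrite (negPf p0) andbF orbF.
Qed.

(** Separability is stable under field extension, so it suffices to look for a
    square factor over the extension that contains the root. *)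
Lemma separable_no_repeated_root (F : fieldType) (p : {poly F}) :
  separable_poly p -> ~ has_repeated_root p.
Proof.
move=> sep [L [iota [a]]].
by rewrite (separable_nosquare (k := 2)) ?separable_map ?size_XsubC.
Qed.

Lemma separable_squarefree (F : fieldType) (p : {poly F}) :
  separable_poly p -> squarefree_poly p.
Proof.
move=> sep d dp; apply/eqP; apply: contraTT dp => sd.
by rewrite (separable_nosquare (k := 2)).
Qed.

Definition wronskian (F : fieldType) (u v : {poly F}) := u^`() * v - u * v^`().

(** Write U, V, W for the Wronskians of (v, w), (w, u), (u, v). At a common root
    r of U and V, the syzygies u U + v V + w W = 0 and u' U + v' V + w' W = 0
    leave w W = w' W = 0, where W(r) = d is nonzero because U + V + W = d; so r
    would be a double root of w. The proof runs this argument with divisors in place of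
    roots, by writing d w and d w' as combinations of U and V. *)
Lemma coprimep_wronskian (F : fieldType) (u v w : {poly F}) (d : F) : d != 0 ->
    wronskian v w + wronskian w u + wronskian u v = d%:P ->
  separable_poly w -> coprimep (wronskian v w) (wronskian w u).
Proof.
move=> d0 sumE; rewrite unlock => /coprimepP sepw.
apply/coprimepP => c cU cV.
have cdvd a b p : d *: p = a * wronskian v w + b * wronskian w u -> c %| p.
  by move=> E; rewrite -(dvdpZr _ _ d0) E dvdp_add ?dvdp_mull.
apply: sepw.
- apply: (cdvd (w - u) (w - v)); rewrite -mul_polyC -sumE /wronskian; ring.
- apply: (cdvd (w - u)^`() (w - v)^`()).
  by rewrite -mul_polyC -sumE /wronskian !derivB; ring.
Qed.

Lemma monic_quadraticE (F : fieldType) (u : {poly F}) :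
    u \is monic -> size u = 3%N ->
  u = 'X^2 + u`_1 *: 'X + (u`_0)%:P.
Proof.
move=> /monicP um su; apply/polyP=> i; rewrite !coefE.
rewrite /lead_coef su /= in um.
case: i => [|[|[|i]]] /=; rewrite ?mulr0 ?mulr1 ?addr0 ?add0r //.
by rewrite nth_default // su.
Qed.

Lemma sub_monic_quadraticE (F : fieldType) (u v : {poly F}) :
    u \is monic -> size u = 3%N -> v \is monic -> size v = 3%N ->
  v - u = (v`_1 - u`_1)%:P * 'X + (v`_0 - u`_0)%:P.
Proof.
move=> um su vm sv.
rewrite {1}(monic_quadraticE um su) {1}(monic_quadraticE vm sv).
by rewrite -!mul_polyC !polyCB; ring.
Qed.

Lemma wronskian_quadraticE (F : fieldType) (u v : {poly F}) :
    u \is monic -> size u = 3%N -> v \is monic -> size v = 3%N ->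
  wronskian u v = (v`_1 - u`_1) *: 'X^2 + (2%:R * (v`_0 - u`_0)) *: 'X
                  + (u`_1 * v`_0 - u`_0 * v`_1)%:P.
Proof.
move=> um su vm sv; rewrite /wronskian.
rewrite (monic_quadraticE um su) (monic_quadraticE vm sv).
move: u`_1 u`_0 v`_1 v`_0 => a b c d.
rewrite !coefE /= !(mulr0, mulr1, addr0, add0r).
rewrite !derivE -!mul_polyC !(polyCB, polyCM, polyC_natr, polyCN).
ring.
Qed.

Lemma frakdE (F : fieldType) (u v w : {poly F}) :
  frakd u v w = - ((v`_1 * w`_0 - v`_0 * w`_1) + (w`_1 * u`_0 - w`_0 * u`_1)
                   + (u`_1 * v`_0 - u`_0 * v`_1)).
Proof.
rewrite /frakd (expand_det_row _ ord0) !big_ord_recl big_ord0 /cofactor.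
rewrite !(expand_det_row _ ord0) !big_ord_recl !big_ord0 /cofactor !det_mx11.
by rewrite !mxE /=; ring.
Qed.

(** The coefficients of X^2 and X in the Wronskians are differences arranged
    cyclically, so they cancel in the sum; the constant terms are the 2 x 2
    minors, up to sign, in the expansion of the determinant along its column of
    ones. *)
Lemma wronskian_quadratic_sum (F : fieldType) (u v w : {poly F}) :
    u \is monic -> size u = 3%N -> v \is monic -> size v = 3%N ->
    w \is monic -> size w = 3%N ->
  wronskian v w + wronskian w u + wronskian u v = (- frakd u v w)%:P.
Proof.
move=> um su vm sv wm sw; rewrite frakdE opprK !wronskian_quadraticE //.
rewrite -!mul_polyC !(polyCB, polyCM, polyC_natr, polyCN, polyCD).
ring.
Qed.

Lemma deriv_wronskian_quadratic (F : fieldType) (u v : {poly F}) :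
    u \is monic -> size u = 3%N -> v \is monic -> size v = 3%N ->
  (wronskian u v)^`() = 2%:R *: (v - u).
Proof.
move=> um su vm sv; rewrite wronskian_quadraticE //.
rewrite sub_monic_quadraticE //.
rewrite !derivE -!mul_polyC !(polyCB, polyCM, polyC_natr, polyCN, polyCD).
ring.
Qed.

(** Otherwise u = v, which is not coprime to itself. *)
Lemma coprimep_coef0_neq (F : fieldType) (u v : {poly F}) :
    u \is monic -> size u = 3%N -> v \is monic -> size v = 3%N ->
  coprimep u v -> u`_1 = v`_1 -> u`_0 != v`_0.
Proof.
move=> um su vm sv cop e1; apply: contraTneq cop => e0.
suff -> : v = u by rewrite coprimepp su.
by rewrite (monic_quadraticE um su) (monic_quadraticE vm sv) e0 e1.
Qed.

(** The derivative of the Wronskian is 2 (v - u), so a repeated root is a root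
    of v - u. Since the Wronskian is also u' (v - u) - u (v - u)' and u is coprime
    to v - u, it is then a root of (v - u)'. But v - u has degree at most 1 and is nonzero,
    so it has no root in common with its derivative. *)
Lemma separable_wronskian_quadratic (F : fieldType) (u v : {poly F}) :
    (2%:R : F) != 0 ->
    u \is monic -> size u = 3%N -> v \is monic -> size v = 3%N ->
  coprimep u v -> separable_poly (wronskian u v).
Proof.
move=> two_neq0 um su vm sv cop; rewrite unlock deriv_wronskian_quadratic //.
rewrite coprimepZr // coprimep_sym.
have subE := sub_monic_quadraticE um su vm sv.
have -> : wronskian u v = u^`() * (v - u) + (u`_1 - v`_1) *: u.
  have -> : v = u + (v - u) by rewrite addrC subrK.
  rewrite /wronskian derivD {2}subE !derivE !coefE -!mul_polyC polyCB; ring.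
rewrite coprimep_addl_mul.
have [e1|n1] := eqVneq u`_1 v`_1.
  rewrite subE e1 subrr mul0r add0r -alg_polyC coprimepZl ?coprime1p //.
  by rewrite subr_eq0 eq_sym coprimep_coef0_neq.
rewrite coprimepZr ?subr_eq0 // coprimep_sym.
by rewrite addrC -mulN1r coprimep_addl_mul.
Qed.

(** If the coefficient v_1 - u_1 of X^2 vanishes, the coefficient 2 (v_0 - u_0)
    of X does not, by coprimality and because 2 is invertible. *)
Lemma size_wronskian_quadratic (F : fieldType) (u v : {poly F}) :
    (2%:R : F) != 0 ->
    u \is monic -> size u = 3%N -> v \is monic -> size v = 3%N ->
  coprimep u v -> size (wronskian u v) = if u`_1 == v`_1 then 2 else 3.
Proof.
move=> two_neq0 um su vm sv cop.
have -> : wronskian u v = ((v`_1 - u`_1)%:P * 'X + (2%:R * (v`_0 - u`_0))%:P)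
                          * 'X + (u`_1 * v`_0 - u`_0 * v`_1)%:P.
  by rewrite wronskian_quadraticE // -!mul_polyC; ring.
rewrite size_MXaddC -size_poly_eq0 size_MXaddC polyC_eq0 size_polyC.
rewrite subr_eq0 [v`_1 == _]eq_sym mulf_eq0 (negPf two_neq0).
rewrite subr_eq0 [v`_0 == _]eq_sym.
have [e1|//] := eqVneq u`_1 v`_1.
by rewrite (negPf (coprimep_coef0_neq um su vm sv cop e1)).
Qed.

Theorem proposition4p6 (F : finFieldType) (u v w : {poly F}) :
  odd #|F| ->
  u \is monic -> size u = 3%N ->
  v \is monic -> size v = 3%N ->
  w \is monic -> size w = 3%N ->
  disc u * disc v * disc w != 0 ->
  resultant u v * resultant v w * resultant w u != 0 ->
  frakd u v w != 0 ->
  let U := v^`() * w - v * w^`() in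
  let V := w^`() * u - w * u^`() in
  let W := u^`() * v - u * v^`() in
  [/\ pairwise_coprimep U V W,
      [/\ ~ has_repeated_root U, ~ has_repeated_root V & ~ has_repeated_root W],
      expected_degrees U V W,
      squarefree_poly (U * V * W) /\
        (size (U * V * W) = 6%N \/ size (U * V * W) = 7%N)
    & post_check U V W].
Proof.
move=> oddF um su vm sv wm sw disc0 res0 d0 U V W.
have two0 := odd_card_two_neq0 oddF.
move: disc0; rewrite 2!mulf_eq0 !negb_or -andbA => /and3P[].
rewrite !disc_neq0 ?monic_neq0 // => sepu sepv sepw.
move: res0; rewrite 2!mulf_eq0 !negb_or -andbA => /and3P[].
rewrite !resultant_neq0 ?monic_neq0 // => cuv cvw cwu.
rewrite -/(wronskian v w) -/(wronskian w u) -/(wronskian u v) in U V W *.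
have d1 : - frakd u v w != 0 by rewrite oppr_eq0.
have sumE : U + V + W = (- frakd u v w)%:P by exact: wronskian_quadratic_sum.
have cUV : coprimep U V by exact: (coprimep_wronskian d1 sumE).
have cVW : coprimep V W.
  by apply: (coprimep_wronskian d1 _ sepu); rewrite -sumE -/V -/W -/U; ring.
have cWU : coprimep W U.
  by apply: (coprimep_wronskian d1 _ sepv); rewrite -sumE -/V -/W -/U; ring.
have sepU : separable_poly U by exact: separable_wronskian_quadratic.
have sepV : separable_poly V by exact: separable_wronskian_quadratic.
have sepW : separable_poly W by exact: separable_wronskian_quadratic.
have sU : size U = if v`_1 == w`_1 then 2 else 3
  by exact: size_wronskian_quadratic.
have sV : size V = if w`_1 == u`_1 then 2 else 3
  by exact: size_wronskian_quadratic.
have sW : size W = if u`_1 == v`_1 then 2 else 3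
  by exact: size_wronskian_quadratic.
have not_all_eq : ~~ ((u`_1 == v`_1) && (v`_1 == w`_1)).
  apply: contra d0 => /andP[/eqP e1 /eqP e2].
  by rewrite frakdE e1 e2; apply/eqP; ring.
have U0 : U != 0 by rewrite -size_poly_gt0 sU; case: ifP.
have V0 : V != 0 by rewrite -size_poly_gt0 sV; case: ifP.
have W0 : W != 0 by rewrite -size_poly_gt0 sW; case: ifP.
have sizes : expected_degrees U V W
    /\ (size (U * V * W) = 6%N \/ size (U * V * W) = 7%N).
  rewrite /expected_degrees /= !size_mul ?mulf_neq0 // sU sV sW.
  move: not_all_eq; have [<-|n1] := eqVneq u`_1 v`_1.
    by rewrite [w`_1 == _]eq_sym /=; case: (u`_1 == w`_1) => //= _; auto.
  have [<-|n2] := eqVneq v`_1 w`_1.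
    by rewrite [v`_1 == _]eq_sym (negPf n1); auto.
  by case: (w`_1 == u`_1); auto.
have [degs sizeUVW] := sizes.
have cop : pairwise_coprimep U V W by rewrite /pairwise_coprimep cUV cVW.
split=> //.
- by split; apply: separable_no_repeated_root.
- split=> //; apply: separable_squarefree.
  by rewrite !separable_mul sepU sepV sepW cUV coprimepMl cVW coprimep_sym cWU.
- by rewrite /post_check degs cop !disc_neq0 // sepU sepV sepW.
Qed.
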